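(* Let $I\subset S=K[x_1,\dots,x_n]$ be a polymatroidal ideal generated in degree two. Then $\mathrm{HS}_k(I)$ is a polymatroidal ideal for all $k\ge0$.
   Context: A polymatroidal ideal is a monomial ideal $I$ generated in a single degree such that for all $u,v\in G(I)$ (minimal monomial generators) and every $i$ with $\deg_{x_i}(u)>\deg_{x_i}(v)$ there exists $j$ with $\deg_{x_j}(u)<\deg_{x_j}(v)$ and $x_ju/x_i\in G(I)$. $\mathrm{HS}_k(I)$ is the monomial ideal generated by $\mathbf x^{\mathbf a}$ for the $k$th multigraded shifts $\mathbf a$ of $I$ (i.e. $F_k=\bigoplus_jS(-\mathbf a_{kj})$ in the minimal multigraded free resolution). By convention the zero ideal is allowed (for $k$ beyond the projective dimension). *)

(* Defs.v *)
From mathcomp Require Import all_boot all_algebra.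
From mathcomp Require Import mpoly.

Set Implicit Arguments.
Unset Strict Implicit.
Unset Printing Implicit Defensive.

Import GRing.Theory.
Local Open Scope ring_scope.

(* Monomial ideals, described by a (finite) set of generating monomials
   given as a predicate on exponent vectors 'X_{1..n}.                 *)

Definition mingens (n : nat) (A : 'X_{1..n} -> Prop) (u : 'X_{1..n}) : Prop :=
  A u /\ forall b : 'X_{1..n}, A b -> (b <= u)%MM -> b = u.

(* The monomial ideal generated by A is polymatroidal:
   generated in a single degree, and the exchange property on G(I):
   for u v in G(I) and i with deg_{x_i} u > deg_{x_i} v there is j with
   deg_{x_j} u < deg_{x_j} v and x_j u / x_i in G(I).
   (The zero ideal, A empty, is allowed and is polymatroidal.) *)
Definition polymatroidal (n : nat) (A : 'X_{1..n} -> Prop) : Prop :=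
  (forall u v, mingens A u -> mingens A v -> mdeg u = mdeg v) /\
  (forall u v (i : 'I_n), mingens A u -> mingens A v -> (v i < u i)%N ->
     exists (j : 'I_n) (w : 'X_{1..n}),
       (u j < v j)%N /\ mingens A w /\ (w + U_(i) = u + U_(j))%MM).

Definition in_monideal (K : fieldType) (n : nat) (G : seq 'X_{1..n})
    (p : {mpoly K[n]}) : Prop :=
  exists c : 'I_(size G) -> {mpoly K[n]},
    p = \sum_(l < size G) c l * 'X_[nth 0%MM G l].

(* Minimal multigraded free resolutions of a monomial ideal.

   F_k = (+)_{j < r k} S(-sh k j) is represented by row vectors
   'rV[S]_(r k); the differential d_{k+1} : F_{k+1} -> F_k is
   v |-> v *m d k, with d k : 'M_(r k.+1, r k) (row i = image of the
   i-th basis vector of F_{k+1}); the augmentation F_0 -> I sends the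
   j-th basis vector to x^(sh 0 j).                                   *)
Record mg_resolution (K : fieldType) (n : nat) := MgRes {
  rk : nat -> nat;
  sh : forall k, 'I_(rk k) -> 'X_{1..n};
  dif : forall k, 'M[{mpoly K[n]}]_(rk k.+1, rk k)
}.
Arguments rk {K n} m k : rename.
Arguments sh {K n} m {k} _ : rename.
Arguments dif {K n} m k : rename.

Definition augm (K : fieldType) (n : nat) (R : mg_resolution K n)
    (v : 'rV[{mpoly K[n]}]_(rk R 0)) : {mpoly K[n]} :=
  \sum_(j < rk R 0) v ord0 j * 'X_[sh R j].
Arguments augm {K n} R v.

Definition is_min_mg_resolution (K : fieldType) (n : nat)
    (G : seq 'X_{1..n}) (R : mg_resolution K n) : Prop :=
  (* multigraded (homogeneous of degree 0) differentials *)
  (forall k (i : 'I_(rk R k.+1)) (j : 'I_(rk R k)),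
     exists c : K,
       dif R k i j = if (sh R j <= sh R i)%MM
                     then c *: 'X_[(sh R i - sh R j)%MM] else 0) /\
  (* minimality: d(F_{k+1}) is contained in m F_k *)
  (forall k (i : 'I_(rk R k.+1)) (j : 'I_(rk R k)),
     (dif R k i j)@_0%MM = 0) /\
  (forall p, (exists v, augm R v = p) <-> in_monideal G p) /\
  (forall v, augm R v = 0 <-> exists w, v = w *m dif R 0) /\
  (forall k (v : 'rV[{mpoly K[n]}]_(rk R k.+1)),
     v *m dif R k = 0 <-> exists w, v = w *m dif R k.+1).

(* HS_k(I): (generating set of) the monomial ideal generated by the
   x^a, a a k-th multigraded shift of the resolution R. *)
Definition HS_gens (K : fieldType) (n : nat) (R : mg_resolution K n) (k : nat)
    : 'X_{1..n} -> Prop :=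
  fun a => exists j : 'I_(rk R k), sh R j = a.

(* Main.v *)
(* Comparing two ways of computing Tor_k(K, I)_a, through the minimal resolution of I and
   through the Koszul complex of x_1, ..., x_n, the multidegree a is a k-th shift iff the
   complex of the squarefree vectors T with x^(a - T) in I carries a nonzero homology class
   on faces with k elements.  Call p and q adjacent when x_p x_q is in I; the exchange
   property says that non-adjacency is transitive on the variables dividing a generator.
   Write 1_X for the exponent vector of the squarefree monomial on X.  The minimal
   a with nonzero homology are then the vectors 1_X with #|X| = k + 2 and X containing two
   distinct adjacent variables, and the vectors 1_X + e_p with #|X| = k + 1, p in X and p
   adjacent to itself, where X consists of variables dividing a generator; for
   these a the nonzero cycles are explicit, and any other a with nonzero homology
   lies above one of them, because otherwise the complex is a cone as far as k-element faces
   are concerned.  The exchange property of this set of vectors is then elementary. *)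

Require Import Defs.
From mathcomp Require Import all_boot all_algebra.
From mathcomp Require Import mpoly.
From mathcomp Require Import zify.

Set Implicit Arguments.
Unset Strict Implicit.
Unset Printing Implicit Defensive.

Import GRing.Theory.
Local Open Scope ring_scope.

(** * The Koszul boundary *)

Section Koszul.
Variables (K : fieldType) (n : nat).
Implicit Types (i j m : 'I_n) (S T : {set 'I_n}).

Definition ksign i S : K := (-1) ^+ #|[set s in S | (s < i)%N]|.

Lemma ksignU i j S : j \notin S -> ksign i (j |: S) = (-1) ^+ (j < i)%N * ksign i S.
Proof.
move=> jS; rewrite /ksign; case: ltnP => ji.
  have -> : [set s in j |: S | (s < i)%N] = j |: [set s in S | (s < i)%N].
    by apply/setP=> s; rewrite !inE; case: eqP => //= ->.
  by rewrite cardsU1 inE (negPf jS) /= exprD.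
rewrite mul1r; congr (_ ^+ #|pred_of_set _|); apply/setP=> s; rewrite !inE.
by case: eqP => // ->; rewrite ltnNge ji (negPf jS).
Qed.

Lemma ksignK i S : ksign i S * ksign i S = 1.
Proof. by rewrite -expr2 sqrr_sign. Qed.

Lemma ksignD1 i S : ksign i (S :\ i) = ksign i S.
Proof.
case: (boolP (i \in S)) => [iS|iS]; last first.
  by congr ksign; apply/setP=> s; rewrite !inE; case: eqP => // ->; rewrite (negPf iS).
by rewrite -{2}(setD1K iS) ksignU ?setD11 // ltnn mul1r.
Qed.

Lemma ksignC i j S : i != j -> i \notin S -> j \notin S ->
  ksign i S * ksign j (i |: S) = - (ksign j S * ksign i (j |: S)).
Proof.
move=> ij iS jS; rewrite !ksignU // [LHS]mulrCA [in RHS]mulrCA -mulNr [ksign j S * _]mulrC.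
congr (_ * _); case: (ltngtP i j) ij => [||/val_inj ->]; rewrite ?eqxx //= ?opprK //.
Qed.

Lemma ksign_neq0 i S : ksign i S != 0.
Proof. by rewrite signr_eq0. Qed.

Variable V : lmodType K.
Implicit Types (v w : {set 'I_n} -> V).

(** A chain [v] stands for the sum of [v T] e_T in an exterior algebra, and [kbd] is contraction:
    e_S arises from each e_T with [T = i |: S]. *)
Definition kbd v S : V := \sum_(i | i \notin S) ksign i S *: v (i |: S).

(** Exterior multiplication by e_m, a contracting homotopy for [kbd]. *)
Definition kcone m v S : V := if m \in S then ksign m S *: v (S :\ m) else 0.

Lemma eq_kbd v w : v =1 w -> kbd v =1 kbd w.
Proof. by move=> e S; apply: eq_bigr => i _; rewrite e. Qed.

Lemma kbdB v w S : kbd (fun T => v T - w T) S = kbd v S - kbd w S.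
Proof. by rewrite /kbd -sumrB; apply: eq_bigr => i _; rewrite scalerBr. Qed.

Lemma kbd0 S : kbd (fun=> 0) S = 0.
Proof. by apply: big1 => i _; rewrite scaler0. Qed.

Lemma kbdK v S : kbd (kbd v) S = 0.
Proof.
pose F i j := ksign i S *: (ksign j (i |: S) *: v (j |: (i |: S))).
have antiF i j : i != j -> i \notin S -> j \notin S -> F i j = - F j i.
  by move=> ij iS jS; rewrite /F !scalerA ksignC // scaleNr setUCA.
have -> : kbd (kbd v) S = \sum_(i | i \notin S) \sum_(j | (j \notin S) && (j != i)) F i j.
  apply: eq_bigr => i iS; rewrite /kbd scaler_sumr; apply: eq_bigl => j.
  by rewrite !inE negb_or andbC.
(* Ordered pairs are split by which index is larger; once the sums are exchanged, [antiF] makes one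
   half the negative of the other. *)
transitivity (\sum_(i | i \notin S) \sum_(j | (j \notin S) && (j < i)%N) F i j
            + \sum_(i | i \notin S) \sum_(j | (j \notin S) && (i < j)%N) F i j).
  rewrite -big_split; apply: eq_bigr => i iS /=.
  rewrite (bigID (fun j : 'I_n => (j < i)%N)) /=; congr (_ + _); apply: eq_bigl => j;
  by rewrite -val_eqE /=; case: (ltngtP j i); rewrite ?andbF ?andbT.
rewrite [X in _ + X](exchange_big_dep (fun j => j \notin S)) /=; last by move=> i j _ /andP[].
rewrite -big_split big1 //= => i iS.
rewrite -[X in _ + X]opprK -sumrN [X in X - _](eq_bigr (fun j => - F j i)); last first.
  by move=> j /andP[jS ji]; rewrite antiF // -val_eqE /= gtn_eqF.
apply/eqP; rewrite subr_eq0; apply/eqP; apply: eq_bigl => j.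
by rewrite iS.
Qed.

Lemma kbd_neq0 v T : kbd v T != 0 ->
  exists2 i, i \notin T & v (i |: T) != 0.
Proof.
move=> nz; have /existsP[i /andP[iT vi]] : [exists i, (i \notin T) && (v (i |: T) != 0)].
  apply: contraR nz => /existsPn nz; apply/eqP/big1 => i iT.
  by have := nz i; rewrite iT negbK => /eqP ->; rewrite scaler0.
by exists i.
Qed.

(** For [m] outside [S], only the term [i = m] of the first summand survives. For [m] in [S], the
    term [i = m] of the second summand is [v S], and the other terms cancel in pairs. *)
Lemma kcone_homotopy m v S : kbd (kcone m v) S + kcone m (kbd v) S = v S.
Proof.
rewrite {2}/kcone; case: (boolP (m \in S)) => mS; last first.
  rewrite addr0 /kbd (bigD1 m) //= big1 ?addr0 => [|i /andP[iS im]].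
    by rewrite /kcone setU11 setU1K // scalerA ksignU // ltnn mul1r ksignK scale1r.
  by rewrite /kcone !inE eq_sym (negPf im) (negPf mS) scaler0.
rewrite {2}/kbd (bigD1 m) ?setD11 //= scalerDr scalerA setD1K // ksignD1 ksignK scale1r.
rewrite addrCA scaler_sumr /kbd (eq_bigl (fun i => (i \notin S :\ m) && (i != m))).
  rewrite -big_split big1 ?addr0 //= => i /andP[iS im].
  rewrite /kcone !inE mS orbT !scalerA.
  have iS' : i \notin S by move: iS; rewrite !inE im.
  have e : (i |: S) :\ m = i |: (S :\ m).
    by apply/setP=> s; rewrite !inE; case: (s =P i) => // ->; rewrite im.
  rewrite e -scalerDl -[X in _ * X](ksignD1 m) -[ksign m S](ksignD1 m).
  rewrite e -{1}(setD1K mS); set X := S :\ m; have mX : m \notin X by rewrite setD11.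
  rewrite (ksignU i mX) -mulrA ksignC // mulrN mulrCA [ksign m X * _]mulrC.
  by rewrite ksignU // signrMK mulrC addNr scale0r.
by move=> i; rewrite !inE; case: (i =P m) => [->|_]; rewrite ?mS ?andbF ?andbT.
Qed.

(** By the homotopy, the cone over a cycle bounds it. Closure of [Q] is asked only on faces of size
    [l], where [v] is supported. *)
Lemma kcone_acyclic (Q : pred {set 'I_n}) l m v :
    (forall T, v T != 0 -> (#|T| == l) && Q T) ->
    (forall T, #|T| = l -> Q T -> m \notin T -> Q (m |: T)) ->
    (forall S, kbd v S = 0) ->
  exists2 w, (forall T, w T != 0 -> (#|T| == l.+1) && Q T) & forall S, kbd w S = v S.
Proof.
move=> supv Qm v0; exists (kcone m v) => [T|S]; last first.
  rewrite -[RHS](kcone_homotopy m); rewrite [kcone _ (kbd v) _]/kcone v0.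
  by rewrite scaler0 if_same addr0.
rewrite /kcone; case: ifP => [mT|]; last by rewrite eqxx.
rewrite scaler_eq0 negb_or => /andP[_ /supv /andP[/eqP cT QT]].
by rewrite (cardsD1 m) mT cT eqxx /= -(setD1K mT) Qm ?setD11.
Qed.
End Koszul.

Lemma kbd_entry (K : fieldType) (n p : nat) (v : {set 'I_n} -> 'rV[K]_p) S j :
  kbd v S 0 j = kbd (fun T => v T 0 j : K^o) S.
Proof. by rewrite summxE; apply: eq_bigr => i _; rewrite mxE. Qed.

Lemma kbdM (K : fieldType) (n p q : nat) (v : {set 'I_n} -> 'rV[K]_p)
    (A : 'M_(p, q)) S :
  kbd (fun T => v T *m A) S = kbd v S *m A.
Proof. by rewrite mulmx_suml; apply: eq_bigr => i _; rewrite scalemxAl. Qed.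

(** * Dimension shifting along an exact complex *)

(* [M] is an exact complex of vector spaces; [P j] says for which faces the j-th basis vector
   is present, and the basis vectors in [top] are those present at the empty face only. *)
Section DimensionShift.
Variables (K : fieldType) (n : nat) (J : nat -> nat).
Variables (M : forall k, 'M[K]_(J k.+1, J k)).
Variables (P : forall k, 'I_(J k) -> pred {set 'I_n}).
Variables (top : forall k, pred 'I_(J k.+1)).
Implicit Types (S T : {set 'I_n}).

Definition supported k T (v : 'rV[K]_(J k)) := forall j, v 0 j != 0 -> P j T.

Definition cyclic k : 'rV[K]_(J k) -> Prop :=
  match k with 0 => fun=> True | k'.+1 => fun v => v *m M k' = 0 end.

Definition chain k l (z : {set 'I_n} -> 'rV[K]_(J k)) :=
  forall T j, z T 0 j != 0 -> (#|T| == l) && P j T.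

(** Vanishing of the [l]-th Koszul homology with coefficients in the cyclic vectors of level [k], a
    syzygy module; at level 0 every vector is cyclic. *)
Definition koszul_acyclic k l :=
  forall z : {set 'I_n} -> 'rV[K]_(J k), chain l z -> (forall T, cyclic (z T)) ->
    (forall S, kbd z S = 0) ->
  exists y, [/\ chain l.+1 y, forall T, cyclic (y T) & forall S, kbd y S = z S].

Hypothesis P_down : forall k (j : 'I_(J k)) i T, P j (i |: T) -> P j T.
Hypothesis P_M : forall k i j T, M k i j != 0 -> P i T -> P j T.
Hypothesis cyclicM : forall k (w : 'rV_(J k.+1)), cyclic (w *m M k).
Hypothesis exactM : forall k T (v : 'rV_(J k)), supported T v -> cyclic v ->
  exists2 w, supported T w & v = w *m M k.
Hypothesis top_set0 : forall k (j : 'I_(J k.+1)) T, top j -> P j T -> T = set0.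
Hypothesis top_P : forall k (j : 'I_(J k.+1)), top j -> P j set0.
Hypothesis cone_P : forall k (j : 'I_(J k.+1)) T0, ~~ top j -> P j T0 ->
  exists m, forall T, P j T -> P j (m |: T).
Hypothesis top_M : forall k (i : 'I_(J k.+2)) (j : 'I_(J k.+1)),
  top j -> P i set0 -> M k.+1 i j = 0.

Lemma chain_kbd k l (z : {set 'I_n} -> 'rV_(J k)) : chain l.+1 z -> chain l (kbd z).
Proof.
move=> cz S j; rewrite kbd_entry => /kbd_neq0[i iS /cz /andP[cS PS]].
by rewrite (P_down PS) andbT -eqSS -(eqP cS) cardsU1 iS.
Qed.

Lemma chainB k l (z y : {set 'I_n} -> 'rV_(J k)) :
  chain l z -> chain l y -> chain l (fun T => z T - y T).
Proof.
move=> cz cy T j; rewrite !mxE; case: (eqVneq (z T 0 j) 0) => [->|/cz //].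
by rewrite sub0r oppr_eq0; apply: cy.
Qed.

Lemma supportedM k T (w : 'rV_(J k.+1)) : supported T w -> supported T (w *m M k).
Proof.
move=> sw j; rewrite mxE => nz.
have [i /andP[/sw Pi Mi]] : exists i, (w 0 i != 0) && (M k i j != 0).
  apply/existsP; apply: contraR nz => /existsPn nz; apply/eqP/big1 => i _.
  by have := nz i; rewrite -negb_or -mulf_eq0 negbK => /eqP.
exact: P_M Mi Pi.
Qed.

Lemma chainM k l (z : {set 'I_n} -> 'rV_(J k.+1)) :
  chain l z -> chain l (fun T => z T *m M k).
Proof.
move=> cz T j nz; have [cT|cT] /= := boolP (#|T| == l).
  by apply: (supportedM _ nz) => i /cz /andP[].
case/eqP: nz; have -> : z T = 0; last by rewrite mul0mx mxE.
by apply/rowP => i; rewrite [RHS]mxE; apply/eqP; apply: contraNT cT => /cz /andP[].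
Qed.

Lemma exact_chain k l (z : {set 'I_n} -> 'rV_(J k)) :
    chain l z -> (forall T, cyclic (z T)) ->
  exists2 y, chain l y & forall T, z T = y T *m M k.
Proof.
move=> cz z0; suff [y yP] : exists y : {set 'I_n} -> 'rV_(J k.+1), forall T,
    (forall j, y T 0 j != 0 -> (#|T| == l) && P j T) /\ z T = y T *m M k.
  by exists y => T; case: (yP T).
apply: (fin_all_exists (U := fun=> 'rV_(J k.+1)) (P := fun T w =>
  (forall j, w 0 j != 0 -> (#|T| == l) && P j T) /\ z T = w *m M k)) => T.
have [cT|cT] /= := boolP (#|T| == l).
  by have [|w] := exactM (T := T) _ (z0 T); [move=> j /cz /andP[] | exists w].
exists 0; split=> [j|]; first by rewrite mxE eqxx.
rewrite mul0mx; apply/rowP => i; rewrite [RHS]mxE; apply/eqP.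
by apply: contraNT cT => /cz /andP[].
Qed.

(** The basis vectors separate. Outside [top] the faces of [j] form a cone by [cone_P]; inside [top]
    only the empty face occurs, where [z] vanishes. *)
Lemma free_acyclic k l (z : {set 'I_n} -> 'rV_(J k.+1)) :
    chain l z -> (forall S, kbd z S = 0) -> (forall j, top j -> z set0 0 j = 0) ->
  exists2 y, chain l.+1 y & forall S, kbd y S = z S.
Proof.
move=> cz z0 ztop.
have [y yP] : exists y : 'I_(J k.+1) -> {set 'I_n} -> K^o, forall j,
    (forall T, y j T != 0 -> (#|T| == l.+1) && P j T) /\ forall S, kbd (y j) S = z S 0 j.
  apply: (fin_all_exists (U := fun=> {set 'I_n} -> K^o) (P := fun j y =>
    (forall T, y T != 0 -> (#|T| == l.+1) && P j T) /\
    forall S, kbd y S = z S 0 j)) => j.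
  have [/existsP[T0 nz]|/existsPn zj] := boolP [exists T, z T 0 j != 0]; last first.
    exists (fun=> 0); split=> [T|S]; first by rewrite eqxx.
    by have /negPn/eqP -> := zj S; rewrite kbd0.
  have /andP[cT0 PT0] := cz _ _ nz.
  have [tj|tj] := boolP (top j).
    by case/eqP: nz; rewrite (top_set0 tj PT0) ztop.
  have [m mP] := cone_P tj PT0.
  have [|T _ /mP // |S|w w1 w2] := @kcone_acyclic K n K^o (P j) l m (fun T => z T 0 j).
  - by move=> T /cz.
  - by rewrite -kbd_entry z0 mxE.
  - by exists w.
exists (fun T => \row_j y j T) => [T j|S].
  by rewrite mxE; apply: (yP j).1.
apply/rowP => j; rewrite kbd_entry -(yP j).2.
by apply: eq_bigr => i _; rewrite mxE.
Qed.

Lemma chain_top0 k l (z : {set 'I_n} -> 'rV_(J k.+1)) j :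
  chain l.+1 z -> top j -> z set0 0 j = 0.
Proof. by move=> cz tj; apply/eqP; apply: contraT => /cz; rewrite cards0. Qed.

(** Minimality enters here: [v] is the image of a [w] supported at the empty face, and [top_M] kills
    the [top] columns there. *)
Lemma cyclic_top0 k (v : 'rV_(J k.+1)) j :
  supported set0 v -> cyclic v -> top j -> v 0 j = 0.
Proof.
move=> sv v0 tj; have [w sw ->] := exactM sv v0.
rewrite mxE big1 // => i _; have [->|/sw Pi] := eqVneq (w 0 i) 0.
  by rewrite mul0r.
by rewrite top_M ?mulr0.
Qed.

(** The connecting isomorphism of 0 -> Z_(k+1) -> F -> Z_k -> 0, with Z the cyclic vectors and F all
    of level [k.+1]. F has homology only from [top] at the empty face, and [cyclic_top0] keeps
    Z_(k+1) away from it, so [l = 0] is no exception. *)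
Lemma koszul_shift k l : koszul_acyclic k.+1 l <-> koszul_acyclic k l.+1.
Proof.
split=> H z cz zc z0.
  (* The boundary of a lift [y] of [z] is a cycle with cyclic values, so some cyclic [x] has the
     same boundary. Then [y - x] bounds some [w], and the image of [w] has boundary [z]. *)
  have [y cy yz] := exact_chain cz zc.
  have bM S : kbd y S *m M k = 0.
    by rewrite -kbdM (eq_kbd (w := z)) ?z0 // => T; rewrite yz.
  have [|x [cx xc xy]] := H _ (chain_kbd cy) bM; first exact: kbdK.
  have [||w cw wy] := free_acyclic (z := fun T => y T - x T) (chainB cy cx).
  - by move=> S; rewrite kbdB xy subrr.
  - by move=> j; apply: chain_top0 (chainB cy cx).
  exists (fun T => w T *m M k); split=> [|T|S]; first exact: chainM.
    exact: cyclicM.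
  by rewrite kbdM wy yz mulmxBl (xc S) subr0.
have ztop j : top j -> z set0 0 j = 0.
  by apply: cyclic_top0 (zc _) => i /cz /andP[].
(* Here [y] need not have cyclic values; its image is a cycle one level down, and subtracting the
   boundary of a lifted primitive [w] makes it cyclic. *)
have [y cy yz] := free_acyclic cz z0 ztop.
have [|||x [cx xc xy]] := H (fun T => y T *m M k); first exact: chainM.
- by move=> T; apply: cyclicM.
- by move=> S; rewrite kbdM yz; apply: zc.
have [w cw wx] := exact_chain cx xc.
exists (fun T => y T - kbd w T); split=> [|T|S].
- exact: chainB (chain_kbd cw).
- by rewrite /= mulmxBl -kbdM (eq_kbd (w := x)) ?xy ?subrr // => S; rewrite wx.
- by rewrite kbdB kbdK subr0 yz.
Qed.

Lemma koszul_acyclic0 k :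
  koszul_acyclic k 0 <-> forall j : 'I_(J k.+1), ~~ top j.
Proof.
split=> [H j|ntop z cz zc z0]; last first.
  have [y cy yz] := exact_chain cz zc.
  have ynd T : T != set0 -> y T = 0.
    move=> T0; apply/rowP=> j; rewrite [RHS]mxE; apply/eqP.
    by apply: contraNT T0 => /cy /andP[]; rewrite cards_eq0.
  have [|j|w cw wy] := free_acyclic cy.
  - move=> S; apply: big1 => i iS; rewrite ynd ?scaler0 //.
    by apply/set0Pn; exists i; rewrite setU11.
  - by rewrite (negPf (ntop j)).
  exists (fun T => w T *m M k); split=> [|T|S]; first exact: chainM.
    exact: cyclicM.
  by rewrite kbdM wy yz.
apply/negP => tj.
(* If the image of this chain were a boundary, [e - kbd x] would be cyclic at the empty face with
   [j]-th coordinate 1, since [x] cannot involve [j] on singletons. This contradicts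
   [cyclic_top0]. *)
pose e (T : {set 'I_n}) : 'rV[K]_(J k.+1) := if T == set0 then delta_mx 0 j else 0.
have ce : chain 0 e.
  move=> T i; rewrite /e; case: (eqVneq T set0) => [->|_]; rewrite mxE ?eqxx //=.
  by case: (i =P j) => [->|]; rewrite ?eqxx // cards0 top_P.
have [|S|y [cy yc ye]] := H _ (chainM ce); first by move=> T; apply: cyclicM.
  rewrite kbdM [kbd _ _]big1 ?mul0mx // => i iS; rewrite /e ifF ?scaler0 //.
  by apply/negbTE/set0Pn; exists i; rewrite setU11.
have [x cx xy] := exact_chain cy yc.
have cex : chain 0 (fun T => e T - kbd x T) := chainB ce (chain_kbd cx).
have : (e set0 - kbd x set0) 0 j = 0.
  apply: cyclic_top0 tj; first by move=> i /cex /andP[].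
  by rewrite /= mulmxBl -kbdM (eq_kbd (w := y)) ?ye ?subrr.
have -> : kbd x set0 0 j = 0 -> (e set0 - kbd x set0) 0 j = 1.
  by rewrite !mxE /e eqxx mxE !eqxx => ->; rewrite subr0.
  by move/eqP; rewrite oner_eq0.
rewrite summxE big1 // => i _; rewrite mxE.
have [->|/cx] := eqVneq (x (i |: set0) 0 j) 0; first by rewrite mulr0.
by move=> /andP[_ /(top_set0 tj)/setP/(_ i)]; rewrite !inE eqxx.
Qed.

Lemma top_koszul k : [exists j : 'I_(J k.+1), top j] <-> ~ koszul_acyclic 0 k.
Proof.
have shift l m : koszul_acyclic l m <-> koszul_acyclic 0 (l + m)%N.
  elim: l m => [|l IH] m; [by split | rewrite addSnnS].
  exact: iff_trans (koszul_shift l m) (IH m.+1).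
have := iff_trans (iff_sym (shift k 0)) (koszul_acyclic0 k).
rewrite addn0 => [[acy_top top_acy]].
split=> [/existsP[j tj] /acy_top/(_ j)|H]; first by rewrite tj.
by apply: contraT => /existsPn /top_acy.
Qed.
End DimensionShift.
Definition mset n (T : {set 'I_n}) : 'X_{1..n} := [multinom (i \in T : nat) | i < n].

(** * Multigraded strands of a minimal resolution *)

Section Strand.
Variables (K : fieldType) (n : nat) (G : seq 'X_{1..n}) (R : mg_resolution K n).
Hypothesis resR : is_min_mg_resolution G R.

(* The augmented resolution in scalar form: level 0 is the ideal itself, in each multidegree
   of dimension at most one, and level [k.+1] is the free module F_k. *)
Definition srk k := if k is k'.+1 then rk R k' else 1%N.

(** The multigrading determines the monomial of each entry, so its scalar suffices. Level 0 has all
    entries 1 because the augmentation sends basis vectors to monomials. *)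
Definition sdif k : 'M[K]_(srk k.+1, srk k) :=
  match k with
  | 0 => const_mx 1
  | k'.+1 => \matrix_(i, j) (dif R k' i j)@_(sh R i - sh R j)
  end.

Definition strand_mem b k (v : 'rV[K]_(rk R k)) := forall j, v 0 j != 0 -> (sh R j <= b)%MM.

(** The component of multidegree [b]. Its section [of_strand] is meaningful on [strand_mem b], where
    the truncated subtraction is exact. *)
Definition to_strand b k (w : 'rV[{mpoly K[n]}]_(rk R k)) : 'rV[K]_(rk R k) :=
  \row_j (if (sh R j <= b)%MM then (w 0 j)@_(b - sh R j) else 0).

Definition of_strand b k (v : 'rV[K]_(rk R k)) : 'rV[{mpoly K[n]}]_(rk R k) :=
  \row_j (v 0 j *: 'X_[b - sh R j]).

Lemma mcoeffMX_le (p : {mpoly K[n]}) (m k : 'X_{1..n}) :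
  (p * 'X_[m])@_k = if (m <= k)%MM then p@_(k - m) else 0.
Proof.
case: ifP => [mk|/negbT mk]; first by rewrite -{1}(submK mk) addmC mcoeffMX.
apply/eqP; rewrite mcoeff_eq0 (perm_mem (msuppMX _ _)).
by apply: contra mk => /mapP[q _ ->]; apply: lem_addr.
Qed.

Lemma sdif_le k i j : sdif k.+1 i j != 0 -> (sh R j <= sh R i)%MM.
Proof.
case: resR => /(_ k i j) [c e] _; rewrite mxE e.
by case: ifP => //; rewrite mcoeff0 eqxx.
Qed.

Lemma difE k i j : dif R k i j = sdif k.+1 i j *: 'X_[sh R i - sh R j].
Proof.
case: resR => /(_ k i j) [c e] _; rewrite mxE e.
by case: ifP => _; rewrite ?mcoeff0 ?scale0r // mcoeffZ mcoeffX eqxx mulr1.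
Qed.

Lemma submD (b c d : 'X_{1..n}) : (d <= c -> c <= b -> b - c + (c - d) = b - d)%MM.
Proof.
move=> /mnm_lepP dc /mnm_lepP cb; apply/mnmP => i; rewrite !mnmE.
by have := dc i; have := cb i; lia.
Qed.

Lemma of_strand_dif b k (v : 'rV_(rk R k.+1)) : strand_mem b v ->
  of_strand b v *m dif R k = of_strand b (v *m sdif k.+1).
Proof.
move=> sv; apply/rowP => j; rewrite !mxE scaler_suml; apply: eq_bigr => i _.
rewrite [of_strand _ _ _ _]mxE difE -scalerAl -scalerAr scalerA.
have [->|/sv ib] := eqVneq (v 0 i) 0; first by rewrite !mul0r !scale0r.
have [->|/sdif_le ji] := eqVneq (sdif k.+1 i j) 0; first by rewrite !mulr0 !scale0r.
by rewrite -mpolyXD submD.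
Qed.

Lemma to_strand_dif b k (w : 'rV_(rk R k.+1)) :
  to_strand b (w *m dif R k) = to_strand b w *m sdif k.+1.
Proof.
apply/rowP => j; rewrite [LHS]mxE [RHS]mxE mxE.
have [jb|jb] := boolP (sh R j <= b)%MM; last first.
  rewrite big1 // => i _; rewrite mxE; case: ifP => [ib|_]; last by rewrite mul0r.
  have [->|/sdif_le ji] := eqVneq (sdif k.+1 i j) 0; first by rewrite mulr0.
  by rewrite (lepm_trans ji ib) in jb.
rewrite raddf_sum; apply: eq_bigr => i _ /=.
rewrite difE -scalerAr mcoeffZ mcoeffMX_le mulrC [to_strand _ _ _ _]mxE.
have [->|/sdif_le ji] := eqVneq (sdif k.+1 i j) 0; first by rewrite !mulr0.
congr (_ * _); have -> : (sh R i - sh R j <= b - sh R j)%MM = (sh R i <= b)%MM.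
  move/mnm_lepP: ji => ji; move/mnm_lepP: jb => jb.
  by apply/mnm_lepP/mnm_lepP => h l; move: (h l) (ji l) (jb l); clear; rewrite !mnmE; lia.
case: ifP => // ib; congr (_@_ _); apply/mnmP => l; rewrite !mnmE.
by move/mnm_lepP/(_ l): ji; move/mnm_lepP/(_ l): jb; clear; lia.
Qed.

Lemma of_strandK b k (v : 'rV_(rk R k)) : strand_mem b v -> to_strand b (of_strand b v) = v.
Proof.
move=> sv; apply/rowP => j; rewrite !mxE mcoeffZ mcoeffX eqxx mulr1.
by case: ifP => // jb; apply/esym/eqP; apply: contraFT jb => /sv.
Qed.

Lemma to_strand_mem b k (w : 'rV_(rk R k)) : strand_mem b (to_strand b w).
Proof. by move=> j; rewrite mxE; case: ifP; rewrite ?eqxx. Qed.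

Lemma augm_of_strand b (v : 'rV_(rk R 0)) : strand_mem b v ->
  augm R (of_strand b v) = (\sum_j v 0 j) *: 'X_[b].
Proof.
move=> sv; rewrite scaler_suml; apply: eq_bigr => j _; rewrite mxE -scalerAl.
by have [->|/sv jb] := eqVneq (v 0 j) 0; rewrite ?scale0r // -mpolyXD submK.
Qed.

Lemma mcoeff_augm b (w : 'rV_(rk R 0)) : (augm R w)@_b = \sum_j to_strand b w 0 j.
Proof. by rewrite raddf_sum; apply: eq_bigr => j _; rewrite mxE /= mcoeffMX_le. Qed.

Lemma in_monidealX (b : 'X_{1..n}) :
  in_monideal G ('X_[b] : {mpoly K[n]}) <-> has (fun g => (g <= b)%MM) G.
Proof.
split=> [[c e]|/hasP[g gG gb]].
  apply: contraT => /hasPn nG; have := oner_eq0 K.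
  have <- : ('X_[b] : {mpoly K[n]})@_b = 1 by rewrite mcoeffX eqxx.
  rewrite e raddf_sum big1 ?eqxx //= => l _.
  by rewrite mcoeffMX_le (negPf (nG _ _)) // mem_nth.
have gs : (index g G < size G)%N by rewrite index_mem.
exists (fun l => if l == Ordinal gs then 'X_[b - g] else 0).
rewrite (bigD1 (Ordinal gs)) //= eqxx nth_index // -mpolyXD submK // big1 ?addr0 // => l.
by move/negPf ->; rewrite mul0r.
Qed.

Lemma augm_delta j : augm R (delta_mx 0 j) = 'X_[sh R j].
Proof.
rewrite /augm (bigD1 j) //= big1 ?addr0 => [|i ij]; rewrite mxE ?eqxx ?mul1r //.
by rewrite (negPf ij) mul0r.
Qed.

Lemma sh0_ideal (j : 'I_(rk R 0)) : has (fun g => (g <= sh R j)%MM) G.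
Proof.
apply/in_monidealX; case: resR => _ [_ [H _]].
by apply/H; exists (delta_mx 0 j); apply: augm_delta.
Qed.

Lemma dif_dif k : dif R k.+1 *m dif R k = 0.
Proof.
case: resR => _ [_ [_ [_ H]]]; apply/row_matrixP => i; rewrite row_mul row0.
apply/H; exists (delta_mx 0 i); exact: rowE.
Qed.

Lemma sdif_sdif k : sdif k.+1 *m sdif k = 0.
Proof.
have memd l (i : 'I_(rk R l)) : strand_mem (sh R i) (delta_mx 0 i : 'rV[K]_(rk R l)).
  by move=> j; rewrite mxE /=; case: (j =P i) => [->|]; rewrite ?lepm_refl ?eqxx.
have to0 l b : to_strand b (0 : 'rV_(rk R l)) = 0.
  by apply/rowP => j; rewrite !mxE mcoeff0 if_same.
apply/row_matrixP => i; rewrite row0 rowE.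
case: k i => [|k] i.
  have := mcoeff_augm (sh R i) (of_strand (sh R i) (delta_mx 0 i) *m dif R 0).
  have -> : augm R (of_strand (sh R i) (delta_mx 0 i) *m dif R 0) = 0.
    by case: resR => _ [_ [_ [H _]]]; apply/H; eexists.
  rewrite to_strand_dif of_strandK // mcoeff0 => e.
  rewrite mulmxA; apply/rowP => j; rewrite [RHS]mxE; apply: etrans (esym e).
  by rewrite mxE; apply: eq_bigr => l _; rewrite [sdif 0 _ _]mxE mulr1.
have := to_strand_dif (sh R i) (of_strand (sh R i) (delta_mx 0 i) *m dif R k.+1).
by rewrite -mulmxA dif_dif mulmx0 to0 to_strand_dif of_strandK // mulmxA.
Qed.

(** A preimage of [of_strand b v] exists over the polynomial ring; its component of multidegree [b]
    is the desired [w]. *)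
Lemma strand_exact b k (v : 'rV_(rk R k)) :
    strand_mem b v -> (if k is _.+1 then v *m sdif k = 0 else \sum_j v 0 j = 0) ->
  exists2 w, strand_mem b w & v = w *m sdif k.+1.
Proof.
move=> sv v0; suff [w e] : exists w, of_strand b v = w *m dif R k.
  exists (to_strand b w); first exact: to_strand_mem.
  by rewrite -to_strand_dif -e of_strandK.
case: resR => _ [_ [_ [H0 H]]]; case: k v sv v0 => [|k] v sv v0.
  by apply/H0; rewrite augm_of_strand // v0 scale0r.
apply/H; rewrite of_strand_dif // v0; apply/rowP => j.
by rewrite !mxE scale0r.
Qed.

Lemma strand_onto b : has (fun g => (g <= b)%MM) G ->
  exists2 w : 'rV_(rk R 0), strand_mem b w & \sum_j w 0 j = 1.
Proof.
move=> /in_monidealX; case: resR => _ [_ [H _]] /H[w e].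
exists (to_strand b w); first exact: to_strand_mem.
by rewrite -mcoeff_augm e mcoeffX eqxx.
Qed.

Variable a : 'X_{1..n}.

Lemma lem_addB (u m : 'X_{1..n}) :
  (u + m <= a)%MM = (m <= a)%MM && (u <= a - m)%MM.
Proof.
apply/mnm_lepP/andP => [h|[/mnm_lepP h1 /mnm_lepP h2] l].
  by split; apply/mnm_lepP => l; have := h l; rewrite !mnmE; lia.
by have := h2 l; have := h1 l; rewrite !mnmE; lia.
Qed.

(** The upper Koszul simplicial complex of the ideal at [a], written additively to avoid truncated
    subtraction. *)
Definition ideal_face T := has (fun g => (g + mset T <= a)%MM) G.

(* Presence of a basis vector in multidegree [a - T]. *)
Definition strand_face k : 'I_(srk k) -> pred {set 'I_n} :=
  match k with
  | 0 => fun=> ideal_face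
  | k'.+1 => fun j T => (sh R j + mset T <= a)%MM
  end.

Lemma mset_sub (S T : {set 'I_n}) : S \subset T -> (mset S <= mset T)%MM.
Proof.
move=> /subsetP ST; apply/mnm_lepP => i; rewrite !mnmE.
by case: (boolP (i \in S)) => // /ST ->.
Qed.

Lemma face_sub (g : 'X_{1..n}) (S T : {set 'I_n}) : S \subset T ->
  (g + mset T <= a -> g + mset S <= a)%MM.
Proof.
move=> /mset_sub/mnm_lepP ST /mnm_lepP Ta; apply/mnm_lepP => i.
by apply: leq_trans (Ta i); rewrite !mnmDE leq_add2l.
Qed.

Lemma mset0 : mset set0 = 0%MM :> 'X_{1..n}.
Proof. by apply/mnmP => i; rewrite !mnmE inE. Qed.

Lemma shift_koszul k :
  (exists j : 'I_(rk R k), sh R j = a) <-> ~ koszul_acyclic sdif strand_face 0 k.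
Proof.
have faceB k' (j : 'I_(rk R k')) T : (sh R j + mset T <= a)%MM -> (sh R j <= a - mset T)%MM.
  by rewrite lem_addB => /andP[].
suff <- : [exists j : 'I_(srk k.+1), sh R (k := k) j == a] <->
    ~ koszul_acyclic sdif strand_face 0 k.
  by split=> [[j ja]|/existsP[j /eqP ja]]; [apply/existsP; exists j; apply/eqP | exists j].
apply: (top_koszul (top := fun k (j : 'I_(srk k.+1)) => sh R j == a)).
- case=> [|k'] j i T; last by apply: face_sub; apply: subsetUr.
  by move=> /hasP[g gG gT]; apply/hasP; exists g => //; apply: face_sub gT; apply: subsetUr.
- case=> [|k'] i j T nz iT; last first.
    move: iT; rewrite /= !lem_addB => /andP[-> iT] /=.
    exact: lepm_trans (sdif_le nz) iT.
  have /hasP[g gG gi] := sh0_ideal i; apply/hasP; exists g => //.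
  move: iT; rewrite /= !lem_addB => /andP[-> iT] /=.
  exact: lepm_trans gi iT.
- case=> [|k'] w //=; rewrite -mulmxA; apply/eqP.
  by rewrite sdif_sdif mulmx0.
- case=> [|k'] T v sv v0.
    (* Level 0: a nonzero [v] means the ideal is nonzero in multidegree [a - mset T], so a scaled
       preimage of 1 lifts [v]. *)
    have [v00|/sv /hasP[g gG]] := eqVneq (v 0 0) 0.
      exists 0; first by move=> j; rewrite mxE eqxx.
      by rewrite mul0mx; apply/rowP=> j; rewrite ord1 v00 mxE.
    rewrite lem_addB => /andP[Ta ga].
    have [|w sw w1] := @strand_onto (a - mset T); first by apply/hasP; exists g.
    exists (v 0 0 *: w) => [j|].
      by rewrite mxE mulf_eq0 negb_or => /andP[_ /sw]; rewrite /= lem_addB Ta.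
    apply/rowP => j; rewrite ord1 -scalemxAl mxE mxE -[LHS]mulr1 -w1; congr (_ * _).
    by apply: eq_bigr => i _; rewrite mxE mulr1.
  have [Ta|nTa] := boolP (mset T <= a)%MM.
    have [||w sw ->] := @strand_exact (a - mset T) k' v.
    - by move=> j /sv /faceB.
    - case: k' v sv v0 => [|k'] v sv //= v0; transitivity ((v *m sdif 0) 0 0).
        by rewrite mxE; apply: eq_bigr => i _; rewrite mxE mulr1.
      by rewrite v0 mxE.
    - by exists w => // j /sw; rewrite /= lem_addB Ta.
  exists 0; first by move=> j; rewrite mxE eqxx.
  rewrite mul0mx; apply/rowP=> j; rewrite mxE; apply/eqP.
  by apply: contraNT nTa => /sv; rewrite /= lem_addB => /andP[].
- move=> k' j T /= /eqP -> /mnm_lepP aT; apply/setP => i; rewrite inE.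
  by have := aT i; rewrite !mnmE; case: (i \in T) => //; lia.
- by move=> k' j /= /eqP ->; rewrite mset0 addm0 lepm_refl.
- move=> k' j T0 /= ja /mnm_lepP jT.
  (* A coordinate strictly below [a] leaves room to add [m] to every face. *)
  have [m jm] : exists m, (sh R j m < a m)%N.
    apply/existsP; apply: contraR ja => /existsPn ja; apply/eqP/mnmP => m.
    by have := ja m; have := jT m; rewrite mnmDE; lia.
  exists m => T /mnm_lepP jT'; apply/mnm_lepP => i; have := jT' i.
  by rewrite !mnmE in_setU1; case: (i =P m) => //= ->; lia.
- move=> k' i j /= /eqP ja; rewrite mset0 addm0 => ia.
  apply/eqP; apply: contraT => nz.
  (* Equal shifts make the entry a scalar, which minimality forces to be zero. *)
  have ij : sh R i = sh R j.
    apply/mnmP => l; have /mnm_lepP/(_ l) := sdif_le nz.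
    by rewrite ja; have /mnm_lepP/(_ l) := ia; lia.
  case: resR => _ [/(_ _ i j) e _]; move: nz; rewrite mxE ij.
  suff -> : (sh R j - sh R j)%MM = 0%MM by rewrite e eqxx.
  by apply/mnmP => l; rewrite !mnmE subnn.
Qed.
End Strand.

(** * Polymatroidal ideals generated in degree two *)

Section Degree2.
Variables (n : nat) (G : seq 'X_{1..n}).
Hypothesis polyG : polymatroidal (fun u => u \in G).
Hypothesis deg2 : forall u, mingens (fun u => u \in G) u -> mdeg u = 2%N.
Implicit Types (p q r s t : 'I_n) (S T X Y B : {set 'I_n}).

Lemma addmAC (b c d : 'X_{1..n}) : (b + c + d = b + d + c)%MM.
Proof. by rewrite -!addmA [(c + d)%MM]addmC. Qed.

Definition edge p q := (U_(p) + U_(q))%MM \in G.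

Definition vertex r := [exists t, edge r t].

Lemma mingens_below (g : 'X_{1..n}) : g \in G ->
  exists2 u, mingens (fun u => u \in G) u & (u <= g)%MM.
Proof.
elim: {g}(mdeg g).+1 {-2}g (ltnSn (mdeg g)) => // d IH g gd gG.
have [/hasP[b bG /andP[bg bng]]|/hasPn nb] := boolP (has (fun b => (b <= g)%MM && (b != g)) G).
  have [|//|u umin ub] := IH b; last by exists u => //; apply: lepm_trans bg.
  have := submK bg; move: bng; case: (eqVneq (g - b)%MM 0%MM) => [->|].
    by rewrite add0m => /eqP + e; rewrite e.
  rewrite -mdeg_eq0 => db _ e; move: gd; rewrite -e mdegD; lia.
exists g; last exact: lepm_refl.
split=> // b bG bg; apply/eqP; apply: contraT => bng.
by have := nb b bG; rewrite bg bng.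
Qed.

Lemma mdeg2P (g : 'X_{1..n}) : mdeg g = 2%N -> exists p q, g = (U_(p) + U_(q))%MM.
Proof.
move=> g2; have [q qg] : exists q, (0 < g q)%N.
  apply/existsP; apply: contraT => /existsPn g0; move: g2.
  by rewrite mdegE big1 // => i _; have := g0 i; lia.
have qle : (U_(q) <= g)%MM.
  by apply/mnm_lepP => i; rewrite mnm1E; case: (q =P i) => [<-|].
have /eqP/mdeg1P[p /eqP gp] : mdeg (g - U_(q)) = 1%N.
  by apply/eqP; rewrite -(eqn_add2r (mdeg U_(q)%MM)) -mdegD submK // mdeg1 g2.
by exists p, q; rewrite -gp submK.
Qed.

Lemma edgeC p q : edge p q = edge q p.
Proof. by rewrite /edge addmC. Qed.

Lemma edge_vertex p q : edge p q -> vertex p.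
Proof. by move=> pq; apply/existsP; exists q. Qed.

Lemma edge_below g : g \in G -> exists p q, edge p q /\ (U_(p) + U_(q) <= g)%MM.
Proof.
move=> /mingens_below[u umin ug]; have [p [q e]] := mdeg2P (deg2 umin).
by exists p, q; rewrite /edge -e; case: umin.
Qed.

Lemma lem_mdeg_eq (b c : 'X_{1..n}) : (b <= c)%MM -> (mdeg c <= mdeg b)%N -> b = c.
Proof.
move=> bc; have := submK bc.
case: (eqVneq (c - b)%MM 0%MM) => [->|]; first by rewrite add0m.
by rewrite -mdeg_eq0 => nz <-; rewrite mdegD; lia.
Qed.

Lemma mdeg_le (b c : 'X_{1..n}) : (b <= c)%MM -> (mdeg b <= mdeg c)%N.
Proof. by move=> /submK <-; rewrite mdegD leq_addl. Qed.

Lemma edge_mingens p q : edge p q <-> mingens (fun u => u \in G) (U_(p) + U_(q))%MM.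
Proof.
split=> [pq|[] //]; have [u umin upq] := mingens_below pq.
by rewrite -(lem_mdeg_eq upq) // (deg2 umin) mdegD !mdeg1.
Qed.

(* With [edge] read as "not parallel", this is transitivity of parallelism
   in the rank-two matroid underlying [G]. *)
Lemma edge_exchange p s r : edge p s -> vertex r -> edge r p || edge r s.
Proof.
move=> ps /existsP[t rt].
have [<-|tp] := eqVneq t p; first by rewrite rt.
have [<-|ts] := eqVneq t s; first by rewrite rt orbT.
(* Exchanging [t] out of x_r x_t against x_p x_s can only bring in [p] or [s]. *)
case: polyG => _ /(_ _ _ t (proj1 (edge_mingens _ _) rt) (proj1 (edge_mingens _ _) ps)).
rewrite !mnmDE !mnm1E eqxx [p == t]eq_sym [s == t]eq_sym (negPf tp) (negPf ts).
case=> [|j [w [jlt [[wG _] e]]]]; first by rewrite addn1.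
have {e} e : w = (U_(r) + U_(j))%MM.
  by apply: (@addIm _ U_(t)%MM); rewrite e addmAC.
rewrite e in wG; move: jlt; rewrite !mnmDE !mnm1E.
have [pj|pj] := eqVneq p j; first by rewrite /edge pj wG.
have [sj|sj] := eqVneq s j; first by rewrite /edge sj wG orbT.
by rewrite ltn0.
Qed.

Lemma edge_double p q : edge p p -> vertex q -> edge p q.
Proof. by move=> pp /(edge_exchange pp); rewrite orbb edgeC. Qed.

(* The minimal generators of HS_k(I). *)
Inductive hs_shift k : 'X_{1..n} -> Prop :=
| HsSquarefree X p q of #|X| = k.+2 & {in X, forall r, vertex r} &
    p \in X & q \in X & p != q & edge p q : hs_shift k (mset X)
| HsDouble X p of #|X| = k.+1 & {in X, forall r, vertex r} &
    p \in X & edge p p : hs_shift k (mset X + U_(p))%MM.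

(** * Exchange property of the candidate shifts *)

Lemma mdeg_mset X : mdeg (mset X) = #|X|.
Proof.
rewrite mdegE -sum1_card [RHS]big_mkcond; apply: eq_bigr => i _.
by rewrite mnmE; case: ifP.
Qed.

Lemma mdeg_hs_shift k b : hs_shift k b -> mdeg b = k.+2.
Proof. by case=> *; rewrite ?mdegD mdeg_mset ?mdeg1; lia. Qed.

Lemma hs_shift_exchange k (a b : 'X_{1..n}) i : hs_shift k a -> hs_shift k b ->
    (b i < a i)%N ->
  exists j w, [/\ (a j < b j)%N, hs_shift k w & (w + U_(i) = a + U_(j))%MM].
Proof.
have msetD1U X j : i \in X -> j \notin X -> (mset (j |: X :\ i) + U_(i) = mset X + U_(j))%MM.
  move=> iX jX; apply/mnmP => l; rewrite !mnmE !inE.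
  case: (eqVneq i l) => [<-|il]; rewrite ?iX /=.
    by case: (eqVneq i j) jX iX => [->|] => [/negPf ->|].
  by case: (eqVneq j l) jX => [<-|] => [/negPf ->|].
have msetD1 X : i \in X -> (mset (X :\ i) + U_(i) = mset X)%MM.
  move=> iX; apply/mnmP => l; rewrite !mnmE !inE eq_sym.
  by case: (eqVneq i l) => [<-|il]; rewrite ?iX ?addn0.
have cardD1U X j : i \in X -> j \notin X -> #|j |: X :\ i| = #|X|.
  by move=> iX jX; rewrite cardsU1 !inE (negPf jX) andbF /= [RHS](cardsD1 i) iX.
have msetU1 X j : j \notin X -> mset (j |: X) = (mset X + U_(j))%MM.
  move=> jX; apply/mnmP => l; rewrite !mnmE !inE [l == j]eq_sym.
  by case: (eqVneq j l) jX => [<-|] => [/negPf ->|]; rewrite ?addn0.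
have notsub X Y : i \in X -> i \notin Y -> (#|X| <= #|Y|)%N -> exists2 j, j \in Y & j \notin X.
  move=> iX iY XY; apply/subsetPn; apply: contraL XY => YX; rewrite -ltnNge.
  rewrite (cardsD1 i X) iX add1n ltnS; apply: subset_leq_card; apply/subsetP => l lY.
  by rewrite !inE (subsetP YX) // andbT; apply: contraNneq iY => <-.
case=> {a} [X p q cX vX pX qX pq epq|X p cX vX pX epp].
  case=> {b} [Y c d cY vY cYc dY cd ecd|Y q' cY vY q'Y eqq].
    rewrite !mnmE; case: (boolP (i \in X)) => iX; last by rewrite ltn0.
    case: (boolP (i \in Y)) => // iY _.
    have vU j : j \in Y -> {in j |: X :\ i, forall r, vertex r}.
      by move=> jY r; rewrite !inE => /orP[/eqP->|/andP[_ /vX]]; first exact: vY.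
    have [m mXi] : exists m, m \in X :\ i.
      by apply/set0Pn; rewrite -card_gt0; have := cardsD1 i X; rewrite iX cX add1n => -[<-].
    have [mi mX] := (andP (etrans (esym (in_setD1 _ _ _)) mXi)).
    (* Some [m] other than [i] is kept, and it is adjacent to an end [c'] of the edge in [Y]. If
       [c'] is new, it replaces [i]; otherwise any [j] of [Y] outside [X] does, and the edge from
       [m] to [c'] (or to [j] when [m = c']) survives. *)
    have [c' c'Y mc] : exists2 c', c' \in Y & edge m c'.
      by have /orP[?|?] := edge_exchange ecd (vX _ mX); [exists c | exists d].
    have [c'X|c'X] := boolP (c' \in X); last first.
      exists c', (mset (c' |: X :\ i)); split; last exact: msetD1U.
        by rewrite !mnmE c'Y (negPf c'X).
      apply: (@HsSquarefree k _ m c'); rewrite ?cardD1U ?inE ?mX ?mi ?eqxx ?orbT //.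
        exact: vU.
      by apply: contraNneq c'X => <-.
    have [j jY jX] := notsub X Y iX iY (eq_leq (etrans cX (esym cY))).
    exists j, (mset (j |: X :\ i)); split; last exact: msetD1U.
      by rewrite !mnmE jY (negPf jX).
    have c'i : c' != i by apply: contraNneq iY => <-.
    have mj : m != j by apply: contraNneq jX => <-.
    have [mc'|mc'] := eqVneq m c'.
      apply: (@HsSquarefree k _ m j); rewrite ?cardD1U ?inE ?mX ?mi ?eqxx ?orbT //.
        exact: vU.
      by apply: edge_double (vY _ jY); rewrite {2}mc'.
    apply: (@HsSquarefree k _ m c'); rewrite ?cardD1U ?inE ?mX ?mi ?c'X ?c'i ?eqxx ?orbT //.
    exact: vU.
  rewrite !mnmE; case: (boolP (i \in X)) => iX; last by rewrite ltn0.
  case: (boolP (i \in Y)) => // iY _.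
  have q'i : q' != i by apply: contraNneq iY => <-.
  have [q'X|q'X] := boolP (q' \in X).
    exists q', (mset (X :\ i) + U_(q'))%MM; split.
    - by rewrite !mnmE q'Y q'X eqxx.
    - apply: HsDouble; rewrite ?inE ?q'X ?q'i //.
        by have := cardsD1 i X; rewrite iX cX add1n => -[<-].
      by move=> r; rewrite inE => /andP[_ /vX].
    - by rewrite addmAC msetD1.
  have [m] : exists m, m \in X :\ i.
    by apply/set0Pn; rewrite -card_gt0; have := cardsD1 i X; rewrite iX cX add1n => -[<-].
  rewrite inE => /andP[mi' mX]; have mi : m != i by move: mi'; rewrite inE.
  exists q', (mset (q' |: X :\ i)); split; last exact: msetD1U.
    by rewrite !mnmE q'Y (negPf q'X).
  apply: (@HsSquarefree k _ q' m); rewrite ?cardD1U ?inE ?mX ?mi ?eqxx ?orbT //.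
  - move=> r; rewrite !inE => /orP[/eqP->|/andP[_ /vX] //]; exact: vY.
  - by apply: contraNneq q'X => ->.
  - exact: edge_double (vX _ mX).
have [<-{i msetD1U msetD1 cardD1U notsub}|pi] := eqVneq p i.
  (* Trading the second copy of [p] for a new vertex [j] yields a squarefree shift, because [p] is
     adjacent to every vertex. *)
  have addj j : j \notin X -> vertex j -> hs_shift k (mset (j |: X)).
    move=> jX vj; apply: (@HsSquarefree k _ p j); rewrite ?inE ?pX ?eqxx ?orbT //.
    - by rewrite cardsU1 jX cX.
    - by move=> r; rewrite !inE => /orP[/eqP->|/vX].
    - by apply: contraNneq jX => <-.
    - exact: edge_double.
  case=> {b} [Y c d cY vY cYc dY cd ecd|Y q cY vY qY eqq] => [_|].
    have [j jY jX] : exists2 j, j \in Y & j \notin X.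
      apply/subsetPn; apply: contraTN isT => /subset_leq_card; lia.
    exists j, (mset (j |: X)); split; last by rewrite msetU1 // addmAC.
      rewrite !mnmE jY (negPf jX); case: (p =P j) => // e; by rewrite -e pX in jX.
    exact: addj (vY _ jY).
  rewrite !mnmE eqxx pX; case: (eqVneq q p) => [<-|qp _]; first by rewrite qY.
  have [qX|qX] := boolP (q \in X).
    exists q, (mset X + U_(q))%MM; split; last by rewrite addmAC.
      by rewrite !mnmE qX qY eqxx eq_sym (negPf qp).
    exact: HsDouble.
  exists q, (mset (q |: X)); split; last by rewrite msetU1 // addmAC.
    by rewrite !mnmE qY (negPf qX) eqxx eq_sym (negPf qp).
  exact: addj (vY _ qY).
move=> hb; rewrite [X in (_ < X)%N]mnmDE mnm1E (negPf pi) addn0 mnmE.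
case: (boolP (i \in X)) => // iX; rewrite ltnS leqn0 => bi.
(* Both forms of [b] supply a large enough [Y] avoiding [i]; a [j] from it replaces [i] while [p]
   stays doubled. *)
have [Y [iY XY vY Yb]] : exists Y,
    [/\ i \notin Y, (#|X| <= #|Y|)%N, {in Y, forall r, vertex r} & (mset Y <= b)%MM].
  have notin Y : (mset Y <= b)%MM -> i \notin Y.
    by move=> /mnm_lepP/(_ i); rewrite (eqP bi) mnmE; case: (i \in Y).
  case: hb notin => [Y c d cY vY _ _ _ _|Y q cY vY _ _] notin; exists Y; split=> //.
  - exact/notin/lepm_refl.
  - by rewrite cX cY.
  - exact: lepm_refl.
  - exact/notin/lem_addr.
  - by rewrite cX cY.
  - exact: lem_addr.
have [j jY jX] := notsub X Y iX iY XY.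
exists j, (mset (j |: X :\ i) + U_(p))%MM; split.
- have pj : p != j by apply: contraNneq jX => <-.
  by have /mnm_lepP/(_ j) := Yb; rewrite !mnmE (negPf jX) (negPf pj) jY.
- apply: HsDouble; rewrite ?cardD1U ?inE ?pX ?pi ?orbT //.
  by move=> r; rewrite !inE => /orP[/eqP->|/andP[_ /vX] //]; apply: vY.
- by rewrite addmAC msetD1U // addmAC.
Qed.

(** All [hs_shift] vectors have degree [k.+2], so they are exactly the minimal elements of [A]. *)
Lemma polymatroidal_hs_shift k (A : 'X_{1..n} -> Prop) :
    (forall b, hs_shift k b -> A b) ->
    (forall a, A a -> exists2 b, hs_shift k b & (b <= a)%MM) ->
  polymatroidal A.
Proof.
move=> hsA Ahs; have minA u : mingens A u <-> hs_shift k u.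
  split=> [[Au umin]|hu].
    by have [b hb bu] := Ahs u Au; rewrite -(umin b (hsA b hb) bu).
  split=> [|b /Ahs[c hc cb] bu]; first exact: hsA.
  apply: lem_mdeg_eq => //; apply: leq_trans (mdeg_le cb).
  by rewrite (mdeg_hs_shift hc) (mdeg_hs_shift hu).
split=> [u v /minA hu /minA hv|u v i /minA hu /minA hv /(hs_shift_exchange hu hv)].
  by rewrite (mdeg_hs_shift hu) (mdeg_hs_shift hv).
by case=> j [w [lt hw e]]; exists j, w; split=> //; split=> //; apply/minA.
Qed.

(** * Koszul homology of the ideal *)

Section Homology.
Variables (K : fieldType) (R : mg_resolution K n).
Implicit Types a : 'X_{1..n}.

Notation ideal_acyclic a k := (koszul_acyclic (sdif R) (strand_face (R := R) G a) 0 k).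

Lemma ideal_faceP a T :
  reflect (exists p q, edge p q /\ (U_(p) + U_(q) + mset T <= a)%MM) (ideal_face G a T).
Proof.
apply: (iffP hasP) => [[g gG gT]|[p [q [pq pqT]]]]; last by exists (U_(p) + U_(q))%MM.
have [p [q [pq pqg]]] := edge_below gG; exists p, q; split=> //.
by rewrite lem_addB; move: gT; rewrite lem_addB => /andP[-> ga] /=; apply: lepm_trans ga.
Qed.

Lemma row1_neq0 (v : 'rV[K]_1) : (v != 0) = (v 0 0 != 0).
Proof.
congr (~~ _); apply/eqP/eqP => [->|v0]; first by rewrite mxE.
by apply/rowP => j; rewrite ord1 v0 mxE.
Qed.

Lemma ideal_cone a k m :
    (forall T, #|T| = k -> ideal_face G a T -> m \notin T -> ideal_face G a (m |: T)) ->
  ideal_acyclic a k.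
Proof.
move=> mP z cz _ z0.
have [T|y cy yz] := kcone_acyclic (m := m) (l := k) (Q := ideal_face G a) _ mP z0.
  by rewrite row1_neq0 => /cz.
exists y; split=> // T j; rewrite ord1 => nz; apply: cy.
by rewrite row1_neq0.
Qed.

(** * From nonzero homology to a shift below *)

Lemma subset_card_between X Y k : X \subset Y -> (#|X| <= k <= #|Y|)%N ->
  exists T, [/\ X \subset T, T \subset Y & #|T| = k].
Proof.
move=> XY /andP[]; elim: k => [|k IH] Xk kY.
  by exists X; split=> //; apply/eqP; rewrite -leqn0.
move: Xk; rewrite leq_eqVlt => /orP[/eqP Xk|Xk].
  by exists X.
have [T [XT TY cT]] := IH Xk (ltnW kY).
have /subsetPn[j jY jT] : ~~ (Y \subset T).
  by apply: contraL kY => /subset_leq_card; rewrite cT -ltnNge ltnS.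
exists (j |: T); split.
- exact: subset_trans XT (subsetUr _ _).
- by rewrite subUset sub1set jY.
- by rewrite cardsU1 jT cT.
Qed.

Lemma edge_face_lt a p q T : (U_(p) + U_(q) + mset T <= a)%MM ->
  ((q == p) + (p \in T) < a p)%N /\ ((p == q) + (q \in T) < a q)%N.
Proof.
move=> /mnm_lepP h; have := (h p, h q); rewrite !mnmE !eqxx.
by case=> hp hq; split; lia.
Qed.

Lemma hs_shift_of_homology a k : ~ ideal_acyclic a k ->
  exists2 b, hs_shift k b & (b <= a)%MM.
Proof.
move=> nacy; pose X := [set i | (0 < a i)%N].
have noncone m : exists T, [/\ #|T| = k, ideal_face G a T, m \notin T &
    ~~ ideal_face G a (m |: T)].
  have [/existsP[T /and4P[/eqP]]|/existsPn noT] := boolP [exists T : {set 'I_n},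
      [&& #|T| == k, ideal_face G a T, m \notin T & ~~ ideal_face G a (m |: T)]].
    by exists T.
  case: nacy; apply: (@ideal_cone a k m) => T cT fT mT; apply: contraT => fmT.
  by have := noT T; rewrite cT eqxx fT mT fmT.
have [p [q [epq pqa]]] : exists p q, edge p q /\ (U_(p) + U_(q) <= a)%MM.
  have [/ideal_faceP[p [q [epq]]]|a0] := boolP (ideal_face G a set0).
    by rewrite mset0 addm0; exists p, q.
  case: nacy => z cz _ _; exists (fun=> 0); split=> // [T j|S].
    by rewrite mxE eqxx.
  rewrite kbd0; apply/rowP => j; rewrite mxE; apply/esym/eqP.
  apply: contraNT a0 => /cz /andP[_ /hasP[g gG gS]]; apply/hasP; exists g => //.
  exact: face_sub (sub0set S) gS.
have [pX qX] : p \in X /\ q \in X.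
  by move: pqa; rewrite -[X in (X <= _)%MM]addm0 -mset0 !inE => /edge_face_lt[];
    split; apply: leq_ltn_trans (leq0n _) _; eassumption.
have Xa T : T \subset X -> (mset T <= a)%MM.
  move=> /subsetP TX; apply/mnm_lepP => i; rewrite mnmE.
  by case: (boolP (i \in T)) => // /TX; rewrite inE.
have aX T : (mset T <= a)%MM -> T \subset X.
  move=> /mnm_lepP Ta; apply/subsetP => i iT; rewrite inE.
  by have := Ta i; rewrite mnmE iT.
have vX : {in X, forall r, vertex r}.
  (* A non-vertex [r] in the support of [a] could be added to every face, since no edge uses it. *)
  move=> r; rewrite inE => ra; have [T [_ /ideal_faceP[p' [q' [epq' Ta]]] _]] := noncone r.
  apply: contraNT => nvr; apply/ideal_faceP; exists p', q'; split=> //.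
  apply/mnm_lepP => i; have /mnm_lepP/(_ i) := Ta; rewrite !mnmE !inE.
  case: (eqVneq i r) => //= -> _.
  have /negPf -> : p' != r by apply: contraNneq nvr => <-; apply: edge_vertex epq'.
  have /negPf -> // : q' != r.
  by apply: contraNneq nvr => <-; rewrite edgeC in epq'; apply: edge_vertex epq'.
have [kX|Xk] := leqP k.+2 #|X|.
  have pqX : [set p; q] \subset X by rewrite subUset !sub1set pX qX.
  have [T [/subsetP pqT TX cT]] : exists T, [/\ [set p; q] \subset T, T \subset X & #|T| = k.+2].
    by apply: subset_card_between; rewrite // kX andbT cards2; case: (p == q).
  have vT : {in T, forall r, vertex r} by move=> r /(subsetP TX)/vX.
  have pT : p \in T by apply: pqT; rewrite !inE eqxx.
  have qT : q \in T by apply: pqT; rewrite !inE eqxx orbT.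
  exists (mset T); last exact: Xa.
  have [pq|pq] := eqVneq p q; last exact: (@HsSquarefree k T p q).
  have /set0Pn[r] : T :\ p != set0.
    by rewrite -card_gt0; have := cardsD1 p T; rewrite pT cT add1n => -[<-].
  rewrite !inE => /andP[rp rT]; apply: (@HsSquarefree k T p r) => //; first by rewrite eq_sym.
  by apply: edge_double (vT _ rT); rewrite {2}pq.
(* The support now has at most [k.+1] elements. The test variable [m] is one of exponent at least 2
   if there is any. *)
have [m mX big] : exists2 m, m \in X & (forall r, 1 < a r -> 1 < a m)%N.
  have [/existsP[r r2]|/existsPn no2] := boolP [exists r, (1 < a r)%N].
    by exists r => //; rewrite inE; apply: ltnW.
  by exists p => // r r2; have := no2 r; rewrite r2.
have [T [cT /ideal_faceP[p' [q' [epq' Ta]]] mT nf]] := noncone m.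
have TX : T \subset X.
  by apply: aX; apply: lepm_trans Ta; apply: lem_addl.
have XmT : X = m |: T.
  apply/esym/eqP; rewrite eqEcard subUset sub1set mX TX cardsU1 mT cT.
  by rewrite add1n; rewrite ltnS in Xk.
have cX : #|X| = k.+1 by rewrite XmT cardsU1 mT cT.
have [ap' aq'] := edge_face_lt Ta.
have pX' : p' \in X by rewrite inE; apply: leq_ltn_trans ap'.
have qX' : q' \in X by rewrite inE; apply: leq_ltn_trans aq'.
have m2 : (1 < a m)%N.
  move: pX' qX'; rewrite XmT !in_setU1 => /orP[/eqP pm|pT] => [/orP[/eqP qm|qT]|_].
  - by move: ap'; rewrite pm qm eqxx (negPf mT).
  - by apply: (big q'); apply: leq_ltn_trans aq'; rewrite qT leq_addl.
  - by apply: (big p'); apply: leq_ltn_trans ap'; rewrite pT leq_addl.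
have [emm|nemm] := boolP (edge m m).
  exists (mset X + U_(m))%MM; first exact: HsDouble.
  apply/mnm_lepP => i; rewrite !mnmE inE.
  case: (eqVneq m i) => [<-|_]; first by rewrite (ltnW m2).
  by rewrite addn0; case: (a i).
(* Without an edge from [m] to itself, x_p' x_q' uses [m] at most once, so exponent 2 leaves room
   for [m] in the face. *)
case/negP: nf; apply/ideal_faceP; exists p', q'; split=> //.
apply/mnm_lepP => i; have /mnm_lepP/(_ i) := Ta; rewrite !mnmE !inE.
case: (eqVneq i m) => //= -> _.
case: (eqVneq p' m) => [pm|_]; case: (eqVneq q' m) => [qm|_] //; last exact: ltnW.
by rewrite pm qm (negPf nemm) in epq'.
Qed.

(** In degree [k.+2] a face with [k.+1] elements would leave a monomial of degree one, so there are
    no nonzero boundaries. *)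
Lemma acyclic_cycle0 a k (z : {set 'I_n} -> 'rV[K]_1) : mdeg a = k.+2 -> ideal_acyclic a k ->
  (forall T, z T 0 0 != 0 -> (#|T| == k) && ideal_face G a T) ->
  (forall S, kbd z S = 0) -> forall S, z S = 0.
Proof.
move=> da acy cz z0 S; have [|//|//|y [cy _ yz]] := acy z.
  by move=> T j; rewrite ord1; apply: cz.
rewrite -yz; apply: big1 => i _; suff -> : y (i |: S) = 0 by rewrite scaler0.
apply/rowP => j; rewrite [RHS]mxE; apply/eqP; apply: contraT => /cy /andP[/eqP cT].
case/ideal_faceP => p [q [_ /mdeg_le]].
by rewrite !mdegD !mdeg1 mdeg_mset cT da ltnn.
Qed.

Definition simplex X T : 'rV[K]_1 := if T == X then const_mx 1 else 0.

Lemma kbd_simplex_neq0 X T : (kbd (simplex X) T != 0) = [exists j in X, T == X :\ j].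
Proof.
apply/idP/existsP => [/kbd_neq0[i iT]|[j /andP[jX /eqP ->]]].
  rewrite /simplex; case: (eqVneq (i |: T) X) => [<- _|]; last by rewrite eqxx.
  by exists i; rewrite setU11 setU1K /=.
rewrite /kbd (bigD1 j) ?setD11 //= big1 ?addr0 => [|i /andP[iX ij]].
  by rewrite /simplex setD1K // eqxx scaler_eq0 (negPf (ksign_neq0 _ _ _))
    row1_neq0 mxE oner_eq0.
rewrite /simplex; case: (eqVneq (i |: X :\ j) X) => [iXj|]; last by rewrite scaler0.
have /setP/(_ j) := iXj; rewrite !inE eqxx jX eq_sym (negPf ij) //.
Qed.

(** The cycle is the boundary of the full simplex on [X]: removing a facet [X :\ j] from the
    multidegree leaves x_p x_j, which is in the ideal by [edge_double]. *)
Lemma homology_of_double X p : {in X, forall r, vertex r} -> p \in X -> edge p p ->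
  ~ ideal_acyclic (mset X + U_(p))%MM #|X|.-1.
Proof.
move=> vX pX epp acy; have cX : #|X|.-1.+1 = #|X| by rewrite (cardsD1 p) pX.
have : kbd (simplex X) (X :\ p) != 0.
  by rewrite kbd_simplex_neq0; apply/existsP; exists p; rewrite pX /=.
rewrite (acyclic_cycle0 _ acy) ?eqxx // => [|T|S].
- by rewrite mdegD mdeg1 mdeg_mset addn1 cX.
- rewrite -row1_neq0 kbd_simplex_neq0 => /existsP[j /andP[jX /eqP ->]].
  have -> /= : #|X :\ j| == #|X|.-1 by rewrite (cardsD1 j X) jX.
  apply/ideal_faceP; exists p, j; split; first exact: edge_double (vX j jX).
  apply/mnm_lepP => i; rewrite !mnmE !inE.
  case: (eqVneq i j) => [->|ij]; first by rewrite jX addn0 addnC.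
  by rewrite addn0 addnC.
- exact: kbdK.
Qed.

(* When the edges contain the complete bipartite graph between [B] and its complement in
   [X], the boundary of the simplex on [X] splits into two halves with a common boundary,
   and this boundary only involves faces in the ideal. *)
Lemma homology_of_squarefree X B p q : B \subset X -> p \in B -> q \in X -> q \notin B ->
    (forall r s, r \in B -> s \in X -> s \notin B -> edge r s) ->
  ~ ideal_acyclic (mset X) #|X|.-2.
Proof.
move=> BX pB qX qB eB acy; have pX : p \in X := subsetP BX _ pB.
have pq : p != q by apply: contraNneq qB => <-.
have cX : #|X|.-2.+2 = #|X|.
  by rewrite (cardsD1 p) pX (cardsD1 q) !inE qX eq_sym pq.
(* The half made of the facets [X :\ j] with [j] in [B]. *)
pose y T := if B \subset T then 0 else kbd (simplex X) T.
have yE T : y T != 0 -> exists j, [/\ j \in B, T = X :\ j & y T = kbd (simplex X) T].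
  rewrite /y; case: ifPn => [|BT]; first by rewrite eqxx.
  rewrite kbd_simplex_neq0 => /existsP[j /andP[jX /eqP e]]; exists j; split=> //.
  apply: contraNT BT => jB; rewrite e; apply/subsetP => i iB; rewrite !inE.
  by rewrite (subsetP BX) // andbT; apply: contraNneq jB => <-.
have : kbd y (X :\ p :\ q) != 0.
  have qT : q |: X :\ p :\ q = X :\ p by rewrite setD1K // !inE qX eq_sym pq.
  rewrite /kbd (bigD1 q) ?setD11 //= big1 ?addr0 => [|i /andP[iT iq]].
    rewrite scaler_eq0 (negPf (ksign_neq0 _ _ _)) /= qT /y ifF.
      by rewrite kbd_simplex_neq0; apply/existsP; exists p; rewrite pX /=.
    by apply/negP => /subsetP/(_ p pB); rewrite !inE eqxx.
  apply/eqP; rewrite scaler_eq0 (negPf (ksign_neq0 _ _ _)) /=.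
  apply: contraT => /yE[j [jB /setP/(_ q)]]; rewrite !inE eqxx qX eq_sym (negPf iq) /=.
  by rewrite andbT => /esym/negbFE/eqP e; rewrite e jB in qB.
rewrite (acyclic_cycle0 _ acy) ?eqxx // => [|T|S]; last exact: kbdK.
  by rewrite mdeg_mset cX.
rewrite -row1_neq0 => nz; have [i iT /yE[j [jB Tj _]]] := kbd_neq0 nz.
have jX := subsetP BX _ jB.
have iXj : i \in X :\ j by rewrite -Tj setU11.
have /andP[ij iX] : (i != j) && (i \in X) by move: iXj; rewrite !inE.
have TE : T = X :\ j :\ i by rewrite -Tj setU1K.
(* If [i] and [j] were both in [B], no facet around [T] would contain [B], and [kbd y T] would be
   the vanishing double boundary. *)
have iB : i \notin B.
  apply: contraNN nz => iB; apply/eqP; rewrite -(kbdK (simplex X) T); apply: eq_bigr => l lT.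
  rewrite /y ifF //; apply/negP => /subsetP sub.
  have /= := (sub i iB, sub j jB); rewrite TE !inE !eqxx /= !andbF !orbF.
  by case=> /eqP il /eqP jl; rewrite il jl eqxx in ij.
have -> /= : #|T| == #|X|.-2.
  by rewrite TE (cardsD1 j X) jX (cardsD1 i (X :\ j)) iXj.
apply/ideal_faceP; exists j, i; split; first exact: eB.
apply/mnm_lepP => l; rewrite TE !mnmE !inE.
case: (eqVneq l i) => [->|li]; first by rewrite iX [j == i]eq_sym (negPf ij).
by rewrite /= addn0; case: (eqVneq l j) => [->|lj]; rewrite ?jX.
Qed.

Lemma homology_of_hs_shift a k : hs_shift k a -> ~ ideal_acyclic a k.
Proof.
case=> {a} [X p q cX vX pX qX pq epq|X p cX vX pX epp]; last first.
  by have := homology_of_double vX pX epp; rewrite cX.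
(* The parallelism class of [p], with [p] included even if adjacent to itself; [edge_exchange] joins
   it completely to the rest of [X]. *)
pose B := [set r in X | (r == p) || ~~ edge p r].
have pB : p \in B by rewrite inE pX eqxx.
have qB : q \notin B by rewrite inE qX eq_sym (negPf pq) epq.
have BX : B \subset X by apply/subsetP => r; rewrite inE => /andP[].
have := homology_of_squarefree BX pB qX qB; rewrite cX; apply=> r s.
rewrite inE => /andP[rX rp] sX; rewrite inE sX negb_or negbK => /andP[_ ps].
case/orP: rp => [/eqP -> //|npr].
by have := edge_exchange ps (vX r rX); rewrite edgeC (negPf npr).
Qed.
End Homology.
End Degree2.

Theorem theorem4p5 (K : fieldType) (n : nat) (G : seq 'X_{1..n}) :
  polymatroidal (fun u => u \in G) ->
  (forall u, mingens (fun u => u \in G) u -> mdeg u = 2%N) ->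
  forall R : mg_resolution K n, is_min_mg_resolution G R ->
  forall k : nat, polymatroidal (HS_gens R k).
Proof.
move=> polyG deg2 R resR k; apply: (polymatroidal_hs_shift polyG deg2 (k := k)) => a.
  by move=> /(homology_of_hs_shift polyG deg2 (R := R)) /(shift_koszul resR).
by move=> /(shift_koszul resR) /(hs_shift_of_homology polyG deg2).
Qed.
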